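(* Let $X,Y$ be normed spaces, let $f\in\mathcal{PL}(X,Y)$, and let $(P_1,T_1,b_1),\dots,(P_m,T_m,b_m)$ be such that each $P_i$ is a polyhedron in $X$, $T_i\in\mathcal{L}(X,Y)$, $b_i\in Y$, $$X=\bigcup_{i=1}^mP_i,\qquad \mathrm{int}(P_i)\neq\emptyset\ \ \text{for all } i,\qquad P_i\cap\mathrm{int}(P_j)=\emptyset\ \ \text{for all } i\neq j,$$ and $f(x)=T_i(x)+b_i$ for all $x\in P_i$ and all $i\in\{1,\dots,m\}$. Let $X_f:=\bigcap_{i=1}^m\mathrm{lin}(P_i)$. Then $X_f$ is a closed subspace of $X$ with $\mathrm{codim}(X_f)<\infty$ and $$T_1(x)=\cdots=T_m(x)\quad\text{for all }x\in X_f.$$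
   Context: $\mathcal{L}(X,Y)$ is the space of continuous linear operators from $X$ to $Y$. A polyhedron in a normed space $Z$ is a set $\{z\in Z:\langle u_i^*,z\rangle\le s_i,\ i=1,\dots,n\}$ with finitely many $u_i^*\in Z^*$, $s_i\in\mathbb{R}$. $\mathcal{PL}(X,Y)$ is the set of functions $f:X\to Y$ for which there are finitely many polyhedra $P_i$ in $X$ with $X=\bigcup_iP_i$, operators $T_i\in\mathcal{L}(X,Y)$ and points $b_i\in Y$ with $f(x)=T_i(x)+b_i$ for all $x\in P_i$. For a convex set $K$, the recession cone is $\mathrm{rec}(K):=\{h: K+\mathbb{R}_+h\subset K\}$ and the linearity space is $\mathrm{lin}(K):=(-\mathrm{rec}(K))\cap\mathrm{rec}(K)$. $\mathrm{int}$ denotes the interior. *)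

(* Defs.v *)
From HB Require Import structures.
From mathcomp Require Import all_boot all_order all_algebra.
From mathcomp Require Import all_classical all_reals all_analysis.
Set Implicit Arguments.
Unset Strict Implicit.
Unset Printing Implicit Defensive.
Import Order.TTheory GRing.Theory Num.Theory.
Import numFieldNormedType.Exports.
Local Open Scope classical_set_scope.
Local Open Scope ring_scope.

(* The dual space Z^* is the set of continuous linear maps into R^o, the field
   R seen as a normed space over itself. *)
Definition polyhedron (R : realType) (Z : normedModType R) (P : set Z) : Prop :=
  exists (n : nat) (u : 'I_n -> {linear Z -> R^o}) (s : 'I_n -> R),
    (forall i, continuous (u i)) /\
    P = [set z | forall i, (u i z : R) <= s i].

Definition PL (R : realType) (X Y : normedModType R) : set (X -> Y) :=
  [set f | exists (m : nat) (P : 'I_m -> set X)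
                  (T : 'I_m -> {linear X -> Y}) (b : 'I_m -> Y),
    [/\ forall i, polyhedron (P i),
        [set: X] = \bigcup_i P i,
        forall i, continuous (T i) &
        forall i x, P i x -> f x = T i x + b i]].

Definition rec_cone (R : realType) (X : normedModType R) (K : set X) : set X :=
  [set h | [set k + t *: h | k in K & t in [set t : R | 0 <= t]] `<=` K].

Definition lin_space (R : realType) (X : normedModType R) (K : set X) : set X :=
  [set - h | h in rec_cone K] `&` rec_cone K.

(* For a linear subspace W of V: the quotient V / W is spanned by the classes
   of finitely many vectors e_i, i.e. dim (V / W) is finite. *)
Definition finite_codim (R : realType) (V : normedModType R) (W : set V) : Prop :=
  exists (n : nat) (e : 'I_n -> V),
    forall x : V, exists c : 'I_n -> R, W (x - \sum_(i < n) c i *: e i).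

(* Main.v *)
(** Continuous functionals [u_k] cutting out a nonempty polyhedron [P] satisfy
    [lin P = \bigcap_k ker u_k], so [X_f] is a finite intersection of kernels of
    continuous functionals, hence closed and of finite codimension.  For [x] in
    [X_f] and [y] in [P_i], also [y + x] is in [P_i], so that
    [f (y + x) - f y = T_i x]; hence [T_i x = T_j x] as soon as [P_i] meets
    [P_j].  The union of the [P_k] with [T_k x = T_i x] and the union of the
    others are therefore complementary closed sets, and [X] is connected. *)
Require Import Defs.
From HB Require Import structures.
From mathcomp Require Import all_boot all_order all_algebra.
From mathcomp Require Import all_classical all_reals all_analysis.
Set Implicit Arguments.
Unset Strict Implicit.
Unset Printing Implicit Defensive.
Import Order.TTheory GRing.Theory Num.Theory.
Import numFieldNormedType.Exports.
Local Open Scope classical_set_scope.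
Local Open Scope ring_scope.

Definition halfspaces (R : realType) (X : normedModType R) (I : Type)
    (u : I -> {linear X -> R^o}) (s : I -> R) : set X :=
  [set z | forall k, (u k z : R) <= s k].

(** The index type is arbitrary, so that this serves both for the functionals of one polyhedron and
    for those of all the polyhedra pooled together. *)
Definition common_kernel (R : realType) (X : normedModType R) (I : Type)
    (u : I -> {linear X -> R^o}) : set X :=
  [set x | forall k, u k x = 0].

Lemma halfspaces_closed (R : realType) (X : normedModType R) (I : Type)
    (u : I -> {linear X -> R^o}) (s : I -> R) :
  (forall k, continuous (u k)) -> closed (halfspaces u s).
Proof.
move=> uc; rewrite (_ : halfspaces u s =
    \bigcap_k (u k @^-1` [set a : R | a <= s k])); last first.
  by apply/seteqP; split=> [z zP k _|z zP k]; [exact: zP|exact: (zP k)].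
apply: closed_bigI => k _; apply: preimage_closed; last exact: closed_le.
by move=> z _; exact: uc.
Qed.

(** On a ray from a point [p] of the polyhedron, a functional that is positive on the direction [h]
    grows beyond every bound; one that is nonpositive on [h] never increases. *)
Lemma rec_cone_halfspaces (R : realType) (X : normedModType R) (I : Type)
    (u : I -> {linear X -> R^o}) (s : I -> R) :
  halfspaces u s !=set0 ->
  rec_cone (halfspaces u s) = [set h | forall k, (u k h : R) <= 0].
Proof.
move=> [p pP]; apply/seteqP; split=> [h hrec k|h h0 _ /= [z zP [t t0 <-]] k].
  rewrite leNgt; apply/negP => uh0.
  have sp : 0 <= s k - u k p by rewrite subr_ge0; exact: pP.
  (* One unit past the parameter at which the ray reaches the bound: [u k (p + t *: h)] equals
     [s k + u k h], which exceeds [s k]. *)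
  pose t : R := (s k - u k p) / u k h + 1.
  have t0 : 0 <= t by rewrite addr_ge0// divr_ge0// ltW.
  have : halfspaces u s (p + t *: h).
    by apply: hrec => /=; exists p => //; exists t.
  move=> /(_ k); rewrite linearD linearZ /= -[_ *: _]/(t * u k h) leNgt.
  by rewrite /t mulrDl mul1r divfK ?gt_eqF// addrA subrKC ltrDl uh0.
rewrite linearD linearZ /= -[_ *: _]/(t * u k h).
by rewrite -[leRHS]addr0 lerD ?zP// mulr_ge0_le0.
Qed.

Lemma lin_space_halfspaces (R : realType) (X : normedModType R) (I : Type)
    (u : I -> {linear X -> R^o}) (s : I -> R) :
  halfspaces u s !=set0 -> lin_space (halfspaces u s) = common_kernel u.
Proof.
move=> P0; rewrite /lin_space rec_cone_halfspaces//; apply/seteqP; split.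
  move=> _ [[h h0 <-] h0'] k; apply/eqP; rewrite eq_le h0' /=.
  by rewrite linearN oppr_ge0 h0.
move=> x x0; split=> [|k]; last by rewrite x0.
by exists (- x) => [k|]; rewrite ?opprK// linearN x0 oppr0.
Qed.

Lemma common_kernel_closed (R : realType) (X : normedModType R) (I : Type)
    (u : I -> {linear X -> R^o}) :
  (forall k, continuous (u k)) -> closed (common_kernel u).
Proof.
move=> uc; rewrite (_ : common_kernel u =
    \bigcap_k (u k @^-1` [set a : R | a = 0])); last first.
  by apply/seteqP; split=> [z zP k _|z zP k]; [exact: zP|exact: (zP k)].
apply: closed_bigI => k _; apply: preimage_closed; last exact: closed_eq.
by move=> z _; exact: uc.
Qed.

Lemma common_kernel_submod (R : realType) (X : normedModType R) (I : Type)
    (u : I -> {linear X -> R^o}) :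
  GRing.submod_closed (mem (common_kernel u)).
Proof.
split=> [|a x y]; first by apply/mem_set => k; rewrite linear0.
move=> /set_mem x0 /set_mem y0; apply/mem_set => k.
by rewrite linearP x0 y0 scaler0 addr0.
Qed.

(** One extra spanning vector is enough. If [v] is nonzero at some [w] in [W], subtracting a
    multiple of [w] brings the value of [v] to zero without leaving [W]; otherwise [v] vanishes on
    [W] already. *)
Lemma finite_codim_kernelI (R : realType) (X : normedModType R) (W : set X)
    (v : {linear X -> R^o}) :
  (forall a x y, W x -> W y -> W (a *: x + y)) ->
  finite_codim W -> finite_codim (W `&` [set x | v x = 0]).
Proof.
move=> Wlin [n [e We]].
have [[w Ww vw]|v0] := pselect (exists2 w, W w & v w <> 0); last first.
  exists n, e => x; have [c Wc] := We x; exists c; split=> //=.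
  by apply: contrapT => vx; apply: v0; exists (x - \sum_(i < n) c i *: e i).
(* The new vector [w] takes index 0 and the old family is shifted by one. *)
exists n.+1, (fun i => if unlift ord0 i is Some j then e j else w) => x.
have [c Wc] := We x; set z := x - _ in Wc.
pose r : R := v z / v w.
exists (fun i => if unlift ord0 i is Some j then c j else r).
rewrite big_ord_recl unlift_none.
under eq_bigr => i _ do rewrite liftK.
rewrite opprD addrCA -/z -scaleNr; split; first exact: Wlin.
rewrite /= linearD linearZ /= -[_ *: _]/(- r * v w) mulNr.
by rewrite /r divfK ?addNr//; exact/eqP.
Qed.

Lemma finite_codim_common_kernel (R : realType) (X : normedModType R)
    (I : finType) (u : I -> {linear X -> R^o}) :
  finite_codim (common_kernel u).
Proof.
(* Restricting to a list of indices allows induction, one kernel at a time. *)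
suff H (s : seq I) : finite_codim [set x | forall k, k \in s -> u k x = 0].
  have [n [e He]] := H (enum I); exists n, e => x; have [c Hc] := He x.
  by exists c => k; apply: Hc; rewrite mem_enum.
elim: s => [|i s IHs].
  by exists 0%N, (fun=> 0) => x; exists (fun=> 0).
rewrite (_ : mkset _ = [set x | forall k, k \in s -> u k x = 0] `&`
    [set x | u i x = 0]); last first.
  apply/seteqP; split=> x /=.
    move=> H; split=> [k ks|]; apply: H; first by rewrite inE ks orbT.
    exact: mem_head.
  by move=> [Hs Hi] k; rewrite inE => /predU1P[->|/Hs].
apply: finite_codim_kernelI => // a x y x0 y0 k ks.
by rewrite linearP x0// y0// scaler0 addr0.
Qed.

(** Pulling [A] back along the line through a point of [A] and any other point reduces the claim to
    the connectedness of the real line. *)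
Lemma clopen_normedMod_setT (R : realType) (X : normedModType R) (A : set X) :
  clopen A -> A !=set0 -> A = [set: X].
Proof.
move=> Acl [x Ax]; apply/seteqP; split=> // y _.
pose line (t : R) : X := x + t *: (y - x).
have line_cont : continuous line.
  by move=> t; apply: cvgD; [exact: cvg_cst|exact: scalel_continuous].
have [Bo Bc] := preimage_clopen Acl line_cont.
have RT : connected [set: R] by apply/connected_intervalP => ? ? _ _ ? _.
have BT : line @^-1` A = [set: R].
  apply: RT; first by exists 0; rewrite /preimage/= /line scale0r addr0.
    by exists (line @^-1` A) => //; rewrite setTI.
  by exists (line @^-1` A) => //; rewrite setTI.
have : (line @^-1` A) 1 by rewrite BT.
by rewrite /preimage/= /line scale1r subrKC.
Qed.

(** To be used with [g k] equal to [T k x] for a fixed [x] in the common kernel. *)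
Lemma finite_closed_cover_const (R : realType) (X : normedModType R)
    (I : finType) (Z : Type) (P : I -> set X) (g : I -> Z) :
  (forall i, closed (P i)) -> (forall i, P i !=set0) ->
  [set: X] = \bigcup_i P i ->
  (forall i j y, P i y -> P j y -> g i = g j) ->
  forall i j, g i = g j.
Proof.
move=> Pcl P0 cover gP i j.
have Ucl (D : set I) : closed (\bigcup_(k in D) P k).
  by apply: closed_bigcup => [|k _]; [exact: finite_finset|exact: Pcl].
pose D := [set k | g k = g i].
(* Pieces with different values of [g] are disjoint, so the complement is again a finite union of
   closed pieces. *)
have DC : ~` (\bigcup_(k in D) P k) = \bigcup_(k in ~` D) P k.
  apply/seteqP; split=> [y nDy|y [k nDk Pky] [l Dl Ply]].
    have : (\bigcup_k P k) y by rewrite -cover.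
    by move=> [k _ Pky]; exists k => // Dk; apply: nDy; exists k.
  by apply: nDk; rewrite /D /= (gP k l y).
have [y Pjy] := P0 j.
have : (\bigcup_(k in D) P k) y.
  rewrite (@clopen_normedMod_setT _ _ (\bigcup_(k in D) P k))//; last first.
    by have [z Piz] := P0 i; exists z, i.
  by split; [rewrite -[X in open X]setCK DC; exact: closed_openC|exact: Ucl].
by move=> [k Dk Pky]; rewrite -Dk; exact: (gP k j y).
Qed.

Theorem theorem3p1 (R : realType) (X Y : normedModType R) (f : X -> Y)
  (hf : PL f)
  (m : nat) (P : 'I_m -> set X) (T : 'I_m -> {linear X -> Y}) (b : 'I_m -> Y)
  (hP : forall i, polyhedron (P i))
  (hT : forall i, continuous (T i))
  (hcover : [set: X] = \bigcup_i P i)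
  (hint : forall i, (P i)° !=set0)
  (hdisj : forall i j, i != j -> P i `&` (P j)° = set0)
  (hfT : forall i x, P i x -> f x = T i x + b i) :
  let Xf := \bigcap_i lin_space (P i) in
  [/\ closed Xf,
      GRing.submod_closed (mem Xf),
      finite_codim Xf &
      forall x, Xf x -> forall i j, T i x = T j x].
Proof.
move=> Xf.
have P0 i : P i !=set0 by have [x /interior_subset Px] := hint i; exists x.
(* Choice turns the descriptions of the polyhedra into families depending on [i]. *)
pose n i := sval (cid (hP i)).
pose u i : 'I_(n i) -> {linear X -> R^o} := sval (cid (svalP (cid (hP i)))).
have us i := svalP (cid (svalP (cid (hP i)))).
pose s i := sval (cid (us i)).
have [uc PE] : (forall i k, continuous (u i k)) /\
    forall i, P i = halfspaces (u i) (s i).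
  by split=> i; have [] := svalP (cid (us i)).
(* All the functionals form one family over a finite sigma type, which makes [Xf] a single common
   kernel. *)
pose v (p : {i : 'I_m & 'I_(n i)}) := u (tag p) (tagged p).
have XfE : Xf = common_kernel v.
  have linE i : lin_space (P i) = common_kernel (u i).
    by have := P0 i; rewrite PE; exact: lin_space_halfspaces.
  apply/seteqP; split=> [x Xfx [i k]|x x0 i _].
    by have := Xfx i I; rewrite linE => /(_ k).
  by rewrite linE => k; exact: (x0 (Tagged _ k)).
rewrite XfE; split.
- by apply: common_kernel_closed => -[i k]; exact: uc.
- exact: common_kernel_submod.
- exact: finite_codim_common_kernel.
move=> x x0; apply: (finite_closed_cover_const (P := P)) => //.
  by move=> i; rewrite PE; apply: halfspaces_closed.
(* The left side does not mention [i], so it compares [T i x] and [T j x] at any common point [y] of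
   [P i] and [P j]. *)
have TE i y : P i y -> f (y + x) - f y = T i x.
  move=> Piy; have Piyx : P i (y + x).
    move: Piy; rewrite PE => Piy k.
    by rewrite linearD (x0 (Tagged _ k)) addr0; exact: Piy.
  rewrite (hfT i)// (hfT i y)// linearD opprD addrACA subrr addr0.
  by rewrite addrAC subrr add0r.
by move=> i j y Piy Pjy; rewrite -(TE i y)// -(TE j y).
Qed.
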